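(* Let $k\ge1$ and $n$ be positive integers. Let $\Gamma(m)$ denote the least common multiple of $1,2,\dots,m$, and define $m_1=m_2=1$, $m_3=2$ and $m_{i+1}=2m_i(m_i-1)\Gamma(2m_i-1)$ for $i\ge3$. If $4m_{2k}$ divides $n$, then there does not exist a set of $k$-maxMOFS$(n;n/2)$.
   Context: A frequency square of type $(n;\lambda)$ is an $n\times n$ array on symbols $\{0,\dots,n/\lambda-1\}$ in which each symbol occurs $\lambda$ times in each row and each column. Two such squares are orthogonal if, when superimposed, each ordered pair of symbols occurs $\lambda^2$ times. A set of $k$-maxMOFS$(n;\lambda)$ is a set of $k$ pairwise orthogonal frequency squares of type $(n;\lambda)$ such that no frequency square of type $(n;\lambda)$ is orthogonal to all of them. *)

(* Defs.v *)
From mathcomp Require Import all_boot all_algebra.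

Set Implicit Arguments.
Unset Strict Implicit.
Unset Printing Implicit Defensive.

(* Arrays are n x n matrices over the symbols {0, ..., n/lam - 1}, encoded as
   'I_(n %/ lam).  For n > 0, a frequency square of type (n; lam) can exist only
   if lam > 0 and lam %| n, so these are not required separately. *)
Definition square (n lam : nat) := 'M['I_(n %/ lam)]_n.

Definition freq_square (n lam : nat) (F : square n lam) : Prop :=
  forall s : 'I_(n %/ lam),
    (forall i : 'I_n, #|[set j : 'I_n | F i j == s]| = lam) /\
    (forall j : 'I_n, #|[set i : 'I_n | F i j == s]| = lam).

Definition orthogonal_squares (n lam : nat) (F G : square n lam) : Prop :=
  forall s t : 'I_(n %/ lam),
    #|[set ij : 'I_n * 'I_n | (F ij.1 ij.2 == s) && (G ij.1 ij.2 == t)]|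
    = lam ^ 2.

Definition MOFS (n lam k : nat) (S : {set square n lam}) : Prop :=
  [/\ #|S| = k,
      forall F, F \in S -> freq_square F
    & forall F G, F \in S -> G \in S -> F != G -> orthogonal_squares F G].

Definition maxMOFS (n lam k : nat) (S : {set square n lam}) : Prop :=
  MOFS k S /\
  ~ exists G : square n lam,
      freq_square G /\ forall F, F \in S -> orthogonal_squares F G.

Definition Gamma (m : nat) : nat := \big[lcmn/1]_(1 <= i < m.+1) i.

(* The sequence is indexed from 1; mseq 0 is a junk value. *)
Fixpoint mseq (i : nat) : nat :=
  if i is j.+1 then
    if j < 2 then 1
    else if j == 2 then 2
    else 2 * mseq j * (mseq j - 1) * Gamma (2 * mseq j - 1)
  else 1.

(* Main.v *)
(* Pair column j with column j + n/2. The entries of the k squares in these two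
   columns assign to each of the n rows a vector of {0,1}^(2k), each coordinate
   being 1 for exactly half of the rows. If half of the rows can be chosen so
   that every coordinate is still 1 for half of the chosen rows, then putting 1
   on the chosen rows in column j and on the other rows in column j + n/2, for
   each pair, gives a frequency square orthogonal to all the given ones.

   To choose them, the rows are partitioned into balanced blocks of size 2 m_i,
   by induction on the number i of coordinates. The (i+1)-st coordinate gives
   each block of size 2 m_i an excess in [-m_i, m_i], with total 0. A zero-sum
   sequence in this range splits into zero-sum pieces of length at most
   c = 2 m_i - 1 (c = 2 if m_i = 1); pieces of equal length l are collected into
   groups of Gamma(c) / l, and fewer than c Gamma(c) blocks are left over, so
   that batches of exactly (c - 1) Gamma(c) blocks with excess 0 can be formed.
   In the end the number of blocks is even, and half of them are chosen. *)
Require Import Defs.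
From mathcomp Require Import all_boot all_algebra.
From mathcomp Require Import all_order zify.

Set Implicit Arguments.
Unset Strict Implicit.
Unset Printing Implicit Defensive.

Import Order.TTheory GRing.Theory Num.Theory.

(** * Zero-sum pieces of integer sequences *)

(** Repeated extraction: [Q] is an invariant that passes to the remainder, and a nonempty [t1] makes
    the size drop. It serves to cut pieces, batches of pieces and balanced pairs. *)
Lemma split_all (T : eqType) (P : pred (seq T)) (Q : seq T -> Prop) (s : seq T) :
    (forall t, Q t -> t != [::] -> exists t1 t2,
      [/\ perm_eq t (t1 ++ t2), t1 != [::], P t1 & Q t2]) ->
  Q s -> exists ss, perm_eq s (flatten ss) /\ all P ss.
Proof.
move=> extract; have [n] := ubnP (size s); elim: n s => // n IHn s lt_s_n Qs.
have [->|s_neq0] := eqVneq s [::]; first by exists [::].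
have [t1 [t2 [Est nt1 Pt1 Qt2]]] := extract s Qs s_neq0.
have lt_t2 : size t2 < n.
  by move: (perm_size Est) nt1; rewrite size_cat -size_eq0; lia.
have [ss [Et2 Pss]] := IHn _ lt_t2 Qt2.
exists (t1 :: ss); split; last by rewrite /= Pt1.
by rewrite (perm_trans Est) //= perm_cat2l.
Qed.

(* Greedy: append a nonnegative term when the current sum is at most 0 and a
   negative one otherwise. *)
Lemma reorder_bounded (T : eqType) (f : T -> int) (a b : nat) (s : seq T) (z : int) :
    (forall x, x \in s -> (- a%:Z <= f x <= b%:Z)%R) ->
    (- a%:Z < z <= b%:Z)%R -> (z + \sum_(x <- s) f x = 0)%R ->
  exists t, perm_eq s t /\
    forall k, (- a%:Z < z + \sum_(x <- take k t) f x <= b%:Z)%R.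
Proof.
have [n] := ubnP (size s); elim: n s z => // n IHn s z lt_s_n fs zab sum0.
have [s0|s_neq0] := eqVneq s [::].
  by exists [::]; split=> [|k]; rewrite ?s0 //= big_nil addr0.
have [x sx zx] : exists2 x, x \in s & (- a%:Z < z + f x <= b%:Z)%R.
  have [z_le0|z_gt0] := lerP z 0.
    have /hasP[x sx fx] : has (fun x => 0 <= f x)%R s.
      apply/negPn/negP => /hasPn fneg.
      have : (\sum_(x <- s) f x <= \sum_(x <- s) -1)%R.
        by rewrite !big_seq; apply: ler_sum => x /fneg; lia.
      rewrite big_const_seq count_predT iter_addr_0.
      by move: s_neq0; rewrite -size_eq0; lia.
    by exists x => //; have := fs x sx; lia.
  have /hasP[x sx fx] : has (fun x => f x < 0)%R s.
    apply/negPn/negP => /hasPn fpos.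
    have : (0 <= \sum_(x <- s) f x)%R.
      by rewrite big_seq; apply: sumr_ge0 => x /fpos; lia.
    by lia.
  by exists x => //; have := fs x sx; lia.
have Es := perm_to_rem sx.
have [||||t [Et tab]] := IHn (rem x s) (z + f x)%R.
- by move: s_neq0; rewrite size_rem // -size_eq0; lia.
- by move=> y /mem_rem; apply: fs.
- exact: zx.
- by move: sum0; rewrite (perm_big _ Es) big_cons addrA.
exists (x :: t); split; first by rewrite (perm_trans Es) // perm_cons.
by case=> [|k] /=; rewrite ?big_nil ?addr0 // big_cons addrA.
Qed.

(* Among the first a + b + 1 partial sums of the reordering, all in ]-a, b], two
   coincide. *)
Lemma zero_sum_piece (T : eqType) (f : T -> int) (a b : nat) (s : seq T) :
    0 < a -> (forall x, x \in s -> (- a%:Z <= f x <= b%:Z)%R) ->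
    (\sum_(x <- s) f x = 0)%R -> s != [::] ->
  exists s1 s2, [/\ perm_eq s (s1 ++ s2), 0 < size s1 <= a + b
                  & (\sum_(x <- s1) f x = 0)%R].
Proof.
move=> a_gt0 fs sum0; rewrite -size_eq0 -lt0n => s_gt0.
have [||t [Est tab]] := @reorder_bounded T f a b s 0%R fs.
- by lia.
- by rewrite add0r.
have [le_s|lt_s] := leqP (size s) (a + b).
  by exists s, [::]; rewrite cats0 s_gt0 le_s.
pose P k := (\sum_(x <- take k t) f x)%R.
have {}tab k : (- a%:Z < P k <= b%:Z)%R by have := tab k; rewrite add0r.
(* The shift by a - 1 sends ]-a, b] to the a + b naturals below a + b. *)
pose v k := absz (P k + a%:Z - 1)%R.
have /uniqPn : ~~ uniq [seq v k | k <- iota 0 (a + b).+1].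
  apply/negP => uniq_v.
  have /(uniq_leq_size uniq_v) :
      {subset [seq v k | k <- iota 0 (a + b).+1] <= iota 0 (a + b)}.
    by move=> _ /mapP[k _ ->]; rewrite mem_iota /v; have := tab k; lia.
  by rewrite size_map !size_iota ltnn.
move=> /(_ 0)[i [j []]]; rewrite size_map size_iota => lt_ij lt_j.
rewrite !(nth_map 0) ?size_iota ?nth_iota //; try lia.
rewrite !add0n => Ev.
have EP : P i = P j by move: Ev (tab i) (tab j); rewrite /v; lia.
have Ej : take j t = take i t ++ take (j - i) (drop i t).
  rewrite -{1}(cat_take_drop i (take j t)) (take_takel _ (ltnW lt_ij)).
  by rewrite take_drop subnK // ltnW.
exists (take (j - i) (drop i t)), (take i t ++ drop j t); split.
- rewrite (perm_trans Est) // -{1}(cat_take_drop j t) Ej.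
  by rewrite catA perm_cat2r perm_catC.
- rewrite size_takel; first by lia.
  by rewrite size_drop -(perm_size Est); lia.
- apply: (addrI (P i)); rewrite addr0 {2}EP /P Ej big_cat //.
Qed.

Lemma flatten_flatten (T : Type) (sss : seq (seq (seq T))) :
  flatten (flatten sss) = flatten (map flatten sss).
Proof. by elim: sss => //= ss sss <-; rewrite flatten_cat. Qed.

(** At m = 1 the formula 2m - 1 would give 1, but the sequence 1, -1 has no zero-sum piece of length
    1. *)
Definition piece_bound (m : nat) := if m == 1 then 2 else 2 * m - 1.

(* If both extreme values m and -m occur they cancel in a piece of length 2;
   otherwise the range is shorter by one, whence 2m - 1 rather than 2m. *)
Lemma zero_sum_short_piece (T : eqType) (f : T -> int) (m : nat) (s : seq T) :
    0 < m -> (forall x, x \in s -> (- m%:Z <= f x <= m%:Z)%R) ->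
    (\sum_(x <- s) f x = 0)%R -> s != [::] ->
  exists s1 s2, [/\ perm_eq s (s1 ++ s2), 0 < size s1 <= piece_bound m
                  & (\sum_(x <- s1) f x = 0)%R].
Proof.
move=> m_gt0 fs sum0 s_neq0; rewrite /piece_bound.
have [m1|m_neq1] := eqVneq m 1.
  by apply: (@zero_sum_piece T f 1 1) => //; rewrite -m1.
have [/hasP[x sx /eqP fx]|/hasPn no_m] := boolP (has (fun x => f x == m%:Z)%R s).
  have [/hasP[y sy /eqP fy]|/hasPn no_Nm] :=
      boolP (has (fun x => f x == - m%:Z)%R s).
    have yx : y \in rem x s.
      move: sy; rewrite (perm_mem (perm_to_rem sx)) inE => /predU1P[E|//].
      by move: fx fy; rewrite E; lia.
    exists [:: x; y], (rem y (rem x s)); split=> /=.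
    - by rewrite (perm_trans (perm_to_rem sx)) // perm_cons perm_to_rem.
    - by lia.
    - by rewrite !big_cons big_nil; lia.
  (* The lower bound is now -(m - 1); since m is not 1, m - 1 is positive, as [zero_sum_piece]
     requires. *)
  have -> : 2 * m - 1 = m.-1 + m by lia.
  apply: zero_sum_piece => //; first by lia.
  by move=> y sy; have := fs y sy; have := no_Nm y sy; lia.
have -> : 2 * m - 1 = m + m.-1 by lia.
apply: zero_sum_piece => //.
by move=> y sy; have := fs y sy; have := no_m y sy; lia.
Qed.

(** * Collecting pieces into batches of prescribed total length *)

Lemma sum_by_weight (T : Type) (w : T -> nat) (c : nat) (s : seq T) :
    all (fun x => w x <= c) s ->
  \sum_(x <- s) w x = \sum_(l < c.+1) l * count (fun x => w x == l) s.
Proof.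
elim: s => [_|x s IHs /= /andP[wx ws]].
  by rewrite big_nil big1 // => l _; rewrite muln0.
rewrite big_cons (IHs ws); under [RHS]eq_bigr => l _ do rewrite mulnDr.
rewrite big_split /=; congr addn.
rewrite (bigD1 (Ordinal (wx : w x < c.+1))) //= eqxx muln1 big1 ?addn0 // => l.
by rewrite -val_eqE /= eq_sym => /negPf->; rewrite muln0.
Qed.

(** Pigeonhole over the weights 1, ..., c: if every class totalled at most g - 1, the sum would be
    below c g. A class of weight l totalling at least g contains g / l elements, which together
    weigh g. *)
Lemma equal_weight_group (T : eqType) (w : T -> nat) (c g : nat) (s : seq T) :
    (forall l, 0 < l <= c -> l %| g) -> 0 < g ->
    all (fun x => w x <= c) s -> 0 < c -> c * g <= \sum_(x <- s) w x ->
  exists s1 s2, perm_eq s (s1 ++ s2) /\ \sum_(x <- s1) w x = g.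
Proof.
move=> dvd_g g_gt0 ws c_gt0; rewrite (sum_by_weight ws) big_ord_recl mul0n add0n.
move=> big_sum.
have [l le_g] : exists l : 'I_c, g <= l.+1 * count (fun x => w x == l.+1) s.
  apply/existsP; apply: contraT => /existsPn small.
  suff: c * g <= \sum_(l < c) g.-1 by rewrite sum_nat_const card_ord; nia.
  apply: leq_trans big_sum _; apply: leq_sum => l _.
  by have := small l; rewrite -ltnNge lift0; lia.
have dvd_l : l.+1 %| g by apply: dvd_g; rewrite /= ltn_ord.
pose a x := w x == l.+1; pose r := g %/ l.+1.
exists (take r (filter a s)), (drop r (filter a s) ++ filter (predC a) s); split.
  by rewrite catA cat_take_drop perm_sym perm_filterC.
have wE x : x \in take r (filter a s) -> w x = l.+1.
  by move=> /mem_take; rewrite mem_filter => /andP[/eqP].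
rewrite (eq_big_seq _ wE) big_const_seq count_predT iter_addn_0 size_takel.
  by rewrite mulnC divnK.
by rewrite size_filter leq_divLR // mulnC.
Qed.

(* Peel off groups of weight g until what remains weighs exactly (c - 1) g. *)
Lemma weight_group (T : eqType) (w : T -> nat) (c g : nat) (s : seq T) :
    (forall l, 0 < l <= c -> l %| g) -> 0 < g ->
    all (fun x => w x <= c) s -> 0 < c ->
    g %| \sum_(x <- s) w x -> c.-1 * g <= \sum_(x <- s) w x ->
  exists s1 s2, perm_eq s (s1 ++ s2) /\ \sum_(x <- s1) w x = c.-1 * g.
Proof.
move=> dvd_g g_gt0 + c_gt0; have [n] := ubnP (\sum_(x <- s) w x).
elim: n s => // n IHn s lt_n ws dvd_s le_s.
have [sum_s|sum_s] := eqVneq (\sum_(x <- s) w x) (c.-1 * g).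
  by exists s, [::]; rewrite cats0.
have le_cg : c * g <= \sum_(x <- s) w x.
  (* A multiple of g that is at least (c - 1) g and differs from it is at least c g. *)
  by move: sum_s le_s; have /dvdnP[q ->] := dvd_s; rewrite eqn_pmul2r // !leq_pmul2r //; lia.
have [s1 [s2 [Es sum1]]] := equal_weight_group dvd_g g_gt0 ws c_gt0 le_cg.
have Esum : \sum_(x <- s) w x = g + \sum_(x <- s2) w x.
  by rewrite (perm_big _ Es) big_cat /= sum1.
have [||||t1 [t2 [Et sum2]]] := IHn s2.
- by lia.
- by move: ws; rewrite (perm_all _ Es) all_cat => /andP[].
- by move: dvd_s; rewrite Esum dvdn_addr.
- by move: le_cg; rewrite Esum; nia.
exists t1, (t2 ++ s1); split=> //.
by rewrite (perm_trans Es) // catA perm_catC perm_cat2r.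
Qed.

(** [split_all] is applied twice: to the terms, giving zero-sum pieces of length at most c, then to
    these pieces weighed by length, giving batches of exactly (c - 1) g terms. *)
Lemma zero_sum_partition (T : eqType) (f : T -> int) (m g : nat) (s : seq T) :
    0 < m -> 0 < g -> (forall l, 0 < l <= piece_bound m -> l %| g) ->
    (forall x, x \in s -> (- m%:Z <= f x <= m%:Z)%R) ->
    (\sum_(x <- s) f x = 0)%R ->
    (piece_bound m).-1 * g %| size s ->
  exists ss, perm_eq s (flatten ss) /\
    all (fun t => (size t == (piece_bound m).-1 * g)
                  && (\sum_(x <- t) f x == 0)%R) ss.
Proof.
move=> m_gt0 g_gt0 dvd_g fs sum0 dvd_s.
set c := piece_bound m in dvd_g dvd_s *; set K := c.-1 * g in dvd_s *.
have c_gt1 : 1 < c by rewrite /c /piece_bound; case: eqP; lia.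
have K_gt0 : 0 < K by rewrite /K; nia.
pose P t := (0 < size t <= c) && (\sum_(x <- t) f x == 0)%R.
pose Q t := (forall x, x \in t -> (- m%:Z <= f x <= m%:Z)%R) /\
            (\sum_(x <- t) f x = 0)%R.
have [|//|ss [Es Pss]] := @split_all _ P Q s.
  move=> t [ft sumt] t_neq0.
  have [t1 [t2 [Et size1 sum1]]] := zero_sum_short_piece m_gt0 ft sumt t_neq0.
  exists t1, t2; split=> //.
  - by rewrite -size_eq0 -lt0n; case/andP: size1.
  - by rewrite /P size1 sum1 eqxx.
  - split=> [x xt2|]; first by apply: ft; rewrite (perm_mem Et) mem_cat xt2 orbT.
    by move: sumt; rewrite (perm_big _ Et) big_cat /= sum1 add0r.
pose Q' (uu : seq (seq T)) := all P uu /\ K %| \sum_(u <- uu) size u.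
pose P' (uu : seq (seq T)) := all P uu && (\sum_(u <- uu) size u == K).
have [||gs [Ess Pgs]] := @split_all _ P' Q' ss.
- move=> uu [Puu dvd_uu] uu_neq0.
  have sum_gt0 : 0 < \sum_(u <- uu) size u.
    case: uu Puu uu_neq0 {dvd_uu} => //= u uu /andP[/andP[/andP[u_gt0 _] _] _] _.
    by rewrite big_cons; lia.
  have [||||u1 [u2 [Eu sum1]]] := @weight_group _ size c g uu dvd_g g_gt0.
  + by apply: sub_all Puu => u /andP[/andP[]].
  + by lia.
  + by apply: dvdn_trans dvd_uu; apply: dvdn_mull.
  + exact: dvdn_leq.
  rewrite -/K in sum1.
  have [Pu1 Pu2] : all P u1 /\ all P u2.
    by apply/andP; rewrite -all_cat -(perm_all _ Eu).
  exists u1, u2; split=> //.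
  + by apply: contraTneq K_gt0 => u1_0; rewrite -sum1 u1_0 big_nil.
  + by rewrite /P' Pu1 sum1 eqxx.
  + split=> //; move: dvd_uu; rewrite (perm_big _ Eu) big_cat /= sum1.
    by rewrite dvdn_addr.
- by split=> //; move: dvd_s; rewrite (perm_size Es) size_flatten sumnE big_map.
exists (map flatten gs); split.
  by rewrite (perm_trans Es) // -flatten_flatten perm_flatten.
rewrite all_map; apply: sub_all Pgs => uu /= /andP[Puu /eqP size_uu].
rewrite size_flatten sumnE big_map size_uu eqxx /= big_flatten /=.
by rewrite big_seq big1 // => u /(allP Puu) /andP[_ /eqP].
Qed.

(** * Arithmetic of [Gamma] and [mseq] *)

Lemma Gamma_gt0 (m : nat) : 0 < Gamma m.
Proof.
rewrite /Gamma big_nat; elim/big_ind: _ => // [x y x_gt0 y_gt0|i /andP[//]].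
by rewrite lcmn_gt0 x_gt0.
Qed.

Lemma dvdn_Gamma (l m : nat) : 0 < l <= m -> l %| Gamma m.
Proof.
elim: m => [|m IHm] l_m; first by lia.
rewrite /Gamma big_nat_recr //=; have [le_lm|lt_ml] := leqP l m.
  by apply: dvdn_trans (dvdn_lcml _ _); apply: IHm; lia.
have -> : l = m.+1 by lia.
exact: dvdn_lcmr.
Qed.

Lemma mseqS (j : nat) : 2 < j ->
  mseq j.+1 = 2 * mseq j * (mseq j - 1) * Gamma (2 * mseq j - 1).
Proof. by case: j => [|[|[|j]]]. Qed.

Lemma mseq_gt1 (j : nat) : 2 < j -> 1 < mseq j.
Proof.
elim: j => // j IHj; rewrite ltnS leq_eqVlt => /predU1P[<- //|j_gt2].
rewrite mseqS //; have := IHj j_gt2; have := Gamma_gt0 (2 * mseq j - 1); nia.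
Qed.

Lemma mseq_gt0 (j : nat) : 0 < mseq j.
Proof. by case: j => [|[|[|j]]] //; apply: ltnW; apply: mseq_gt1. Qed.

(** Puts the recursion in one form. For j > 2, g is [Gamma (2 * mseq j - 1)] and c - 1 = 2 (m_j -
    1); for j = 2, m_j = 1, c = 2 and g = 2 give m_3 = 2. *)
Lemma mseq_piece_bound (j : nat) : 1 < j ->
  exists g, [/\ 0 < g, forall l, 0 < l <= piece_bound (mseq j) -> l %| g
              & mseq j.+1 = mseq j * ((piece_bound (mseq j)).-1 * g)].
Proof.
rewrite leq_eqVlt => /predU1P[<-|j_gt2].
  by exists 2; split=> // -[|[|[|l]]].
have m_gt1 := mseq_gt1 j_gt2; rewrite mseqS // /piece_bound.
have -> : (mseq j == 1) = false by lia.
exists (Gamma (2 * mseq j - 1)); split; first exact: Gamma_gt0.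
  by move=> l; apply: dvdn_Gamma.
by rewrite mulnA; congr muln; nia.
Qed.

(** * Balanced blocks of rows *)

Definition balanced (T : Type) (b : pred T) (s : seq T) := 2 * count b s == size s.

Lemma balanced_perm (T : eqType) (b : pred T) (s t : seq T) :
  perm_eq s t -> balanced b s = balanced b t.
Proof. by move=> Est; rewrite /balanced (perm_size Est) (permP Est). Qed.

Lemma balanced_eq_bool (T : Type) (b : pred T) (s : seq T) (c : bool) :
  balanced b s -> balanced (fun x => b x == c) s.
Proof.
case: c => /eqP bs.
  by rewrite /balanced (@eq_count _ _ b) ?bs // => x; rewrite eqb_id.
rewrite /balanced (@eq_count _ _ (predC b)) => [|x]; last by rewrite /= eqbF_neg.
by have := count_predC b s; lia.
Qed.

(** The elements agreeing with x on [b1] and those agreeing on [b2] each fill half of s. Both halves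
    contain x, so their union misses some y. *)
Lemma opposite_pair (T : eqType) (b1 b2 : pred T) (s : seq T) (x : T) :
    balanced b1 s -> balanced b2 s -> x \in s ->
  exists y, [/\ y \in s, b1 y = ~~ b1 x & b2 y = ~~ b2 x].
Proof.
move=> /balanced_eq_bool-/(_ (b1 x)) /eqP bal1.
move=> /balanced_eq_bool-/(_ (b2 x)) /eqP bal2 sx.
pose c1 y := b1 y == b1 x; pose c2 y := b2 y == b2 x.
have : ~~ all (predU c1 c2) s.
  apply/negP; rewrite all_count => /eqP all_s.
  have : 0 < count (predI c1 c2) s.
    by rewrite -has_count; apply/hasP; exists x; rewrite //= /c1 /c2 !eqxx.
  have := count_predUI c1 c2 s; rewrite -/c1 -/c2 in bal1 bal2; lia.
case/allPn => y sy; rewrite /= negb_or /c1 /c2 => /andP[ne1 ne2].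
exists y; split=> //.
  by move: ne1; case: (b1 y) (b1 x) => [] [].
by move: ne2; case: (b2 y) (b2 x) => [] [].
Qed.

(** Base case of the block induction: two coordinates, blocks of size 2 = 2 m_2. *)
Lemma balanced_pairs (T : eqType) (b1 b2 : pred T) (s : seq T) :
    balanced b1 s -> balanced b2 s ->
  exists ss, perm_eq s (flatten ss) /\
    all (fun t => [&& size t == 2, balanced b1 t & balanced b2 t]) ss.
Proof.
move=> bal1 bal2.
apply: (@split_all _ _ (fun t => balanced b1 t /\ balanced b2 t)) => //.
case=> // x t [] {}bal1 {}bal2 _.
have [y [ty Ey1 Ey2]] := opposite_pair bal1 bal2 (mem_head x t).
have {}ty : y \in t.
  by move: ty; rewrite inE => /predU1P[Exy|//]; move: Ey1; rewrite Exy; case: (b1 x).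
have Et : perm_eq (x :: t) ([:: x; y] ++ rem y t).
  by rewrite perm_cons perm_to_rem.
exists [:: x; y], (rem y t); split=> //.
  by rewrite /balanced /= Ey1 Ey2; case: (b1 x) (b2 x) => [] [].
move: bal1 bal2; rewrite !(balanced_perm _ Et) /balanced !count_cat /= Ey1 Ey2.
by split; move: bal1 bal2; case: (b1 x) (b2 x) => [] []; lia.
Qed.

Lemma balanced_flatten (T : Type) (b : pred T) (ss : seq (seq T)) :
  all (balanced b) ss -> balanced b (flatten ss).
Proof.
elim: ss => // s ss IHss /= /andP[/eqP bs /IHss/eqP bss].
by rewrite /balanced count_cat size_cat mulnDr bs bss.
Qed.

Lemma all_balanced_flatten (T : Type) (bs : seq (pred T)) (ss : seq (seq T)) :
    all (fun s => all (fun b => balanced b s) bs) ss ->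
  all (fun b => balanced b (flatten ss)) bs.
Proof.
elim: bs => //= b bs IHbs bal; apply/andP; split.
  by apply: balanced_flatten; apply: sub_all bal => s /andP[].
by apply: IHbs; apply: sub_all bal => s /andP[].
Qed.

Lemma size_flatten_const (T : Type) (m : nat) (ss : seq (seq T)) :
  all (fun s => size s == m) ss -> size (flatten ss) = m * size ss.
Proof.
by elim: ss => [|s ss IHss] /= => [|/andP[/eqP s_m /IHss ss_m]];
  rewrite ?muln0 // size_cat s_m ss_m mulnS.
Qed.

(** Translates between balance and zero excess, both for the whole sequence and for each batch of
    blocks. *)
Lemma sum_excess_eq0 (T : Type) (b : pred T) (m : nat) (ss : seq (seq T)) :
    all (fun s => size s == 2 * m) ss ->
  (\sum_(s <- ss) ((count b s)%:Z - m%:Z) == 0)%R = balanced b (flatten ss).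
Proof.
move=> size_ss; rewrite /balanced (size_flatten_const size_ss) -mulnA eqn_pmul2l //.
have -> : (\sum_(s <- ss) ((count b s)%:Z - m%:Z)
           = (count b (flatten ss))%:Z - (m * size ss)%:Z)%R.
  elim: {size_ss} ss => [|s ss IHss]; first by rewrite big_nil muln0.
  by rewrite big_cons IHss /= count_cat mulnS; lia.
by rewrite subr_eq0 eqz_nat.
Qed.

(** The new coordinate is the head [b]. Flattening a batch of K blocks with total excess 0 balances
    [b] and keeps the tail coordinates balanced. *)
Lemma balanced_partition (T : eqType) (bs : seq (pred T)) (s : seq T) :
    1 < size bs -> 2 * mseq (size bs) %| size s ->
    all (fun b => balanced b s) bs ->
  exists ss, perm_eq s (flatten ss) /\
    all (fun t => (size t == 2 * mseq (size bs))
                  && all (fun b => balanced b t) bs) ss.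
Proof.
elim: bs => // b bs IHbs; have [lt2|] := ltnP 1 (size bs); last first.
  case: bs {IHbs} => [|b' [|//]] //= _ _ _ /and3P[bal bal' _].
  have [ss [Es Pss]] := balanced_pairs bal bal'.
  by exists ss; split=> //; apply: sub_all Pss => t; rewrite andbT.
move=> _ dvd_s /andP[bal_b bal_bs].
have [g [g_gt0 dvd_g Em]] := mseq_piece_bound lt2.
have m_gt0 := mseq_gt0 (size bs).
rewrite [size (b :: bs)]/= Em in dvd_s *.
move: (mseq _) m_gt0 dvd_g IHbs dvd_s {Em} => m m_gt0 dvd_g IHbs dvd_s.
set K := _.-1 * g in dvd_s *.
have [|ss [Es Pss]] := IHbs lt2 _ bal_bs.
  by apply: dvdn_trans dvd_s; rewrite mulnA dvdn_mulr.
have /andP[size_ss bal_ss] : all (fun t => size t == 2 * m) ss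
    && all (fun t => all (fun b => balanced b t) bs) ss.
  by rewrite -all_predI.
have size_s : size s = 2 * m * size ss.
  by rewrite (perm_size Es) (size_flatten_const size_ss).
pose f (t : seq T) := ((count b t)%:Z - m%:Z)%R.
have [|||gs [Ess Pgs]] := @zero_sum_partition _ f m g ss m_gt0 g_gt0 dvd_g.
- move=> t /(allP size_ss) /eqP size_t; by have := count_size b t; rewrite /f; lia.
- by apply/eqP; rewrite sum_excess_eq0 // -(balanced_perm _ Es).
- by move: dvd_s; rewrite size_s mulnA dvdn_pmul2l // muln_gt0.
exists (map flatten gs); split.
  by rewrite (perm_trans Es) // -flatten_flatten perm_flatten.
rewrite all_map; apply/allP => ts gs_ts /=.
have /andP[/eqP size_ts /eqP sum_ts] := allP Pgs _ gs_ts.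
have sub_ts : {subset ts <= ss}.
  by move=> t ts_t; rewrite (perm_mem Ess); apply/flattenP; exists ts.
have size2m : all (fun t => size t == 2 * m) ts.
  by apply/allP => t /sub_ts; apply: (allP size_ss).
rewrite (size_flatten_const size2m) size_ts -/K -mulnA eqxx /=; apply/andP; split.
  by rewrite -(sum_excess_eq0 _ size2m); apply/eqP.
by apply: all_balanced_flatten; apply/allP => t /sub_ts; apply: (allP bal_ss).
Qed.

Lemma balanced_half (T : eqType) (bs : seq (pred T)) (s : seq T) :
    1 < size bs -> 4 * mseq (size bs) %| size s ->
    all (fun b => balanced b s) bs ->
  exists s1 s2, [/\ perm_eq s (s1 ++ s2), size s = 2 * size s1
                  & all (fun b => balanced b s1) bs].
Proof.
move=> size_bs /dvdnP[q size_s] bal_s.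
have [|ss [Es Pss]] := balanced_partition size_bs _ bal_s.
  by rewrite size_s dvdn_mull // dvdn_pmul2r // mseq_gt0.
have size_ss : all (fun t => size t == 2 * mseq (size bs)) ss.
  by apply: sub_all Pss => t /andP[].
have Eq : size ss = 2 * q.
  have := perm_size Es; rewrite size_s (size_flatten_const size_ss).
  have := mseq_gt0 (size bs); nia.
exists (flatten (take q ss)), (flatten (drop q ss)); split; last 1 first.
- by apply: all_balanced_flatten; apply/allP => t /mem_take /(allP Pss) /andP[].
- by rewrite -flatten_cat cat_take_drop.
- rewrite size_s (@size_flatten_const _ (2 * mseq (size bs))); last first.
    by apply/allP => t /mem_take; apply: (allP size_ss).
  by rewrite size_takel ?Eq; lia.
Qed.

(** * Passing from sequences to finite sets *)

Lemma card_uniq_count (T : finType) (b : pred T) (s : seq T) :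
  uniq s -> #|[set x in s | b x]| = count b s.
Proof.
move=> uniq_s; rewrite -size_filter -(card_uniqP (filter_uniq b uniq_s)).
by apply: eq_card => x; rewrite !inE mem_filter andbC.
Qed.

Lemma balanced_half_set (T : finType) (bs : seq (pred T)) :
    1 < size bs -> 4 * mseq (size bs) %| #|T| ->
    all (fun b => 2 * #|[set x | b x]| == #|T|) bs ->
  exists R : {set T}, 2 * #|R| = #|T| /\
    all (fun b => 2 * #|[set x in R | b x]| == #|R|) bs.
Proof.
move=> size_bs; rewrite [#|T|]cardE => dvd_T bal.
have [|s1 [s2 [Es size_s bal1]]] := balanced_half size_bs dvd_T.
  apply: sub_all bal => b /eqP; rewrite /balanced => <-.
  rewrite -(card_uniq_count _ (enum_uniq T)).
  by apply/eqP; congr muln; apply: eq_card => x; rewrite !inE mem_enum.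
have uniq_s1 : uniq s1.
  by have := enum_uniq T; rewrite (perm_uniq Es) cat_uniq => /and3P[].
have size_R : #|[set x in s1]| = size s1.
  by rewrite cardsE; apply/card_uniqP.
exists [set x in s1]; rewrite size_R size_s; split=> //.
apply: sub_all bal1 => b /eqP <-; rewrite -(card_uniq_count _ uniq_s1).
by apply/eqP; congr muln; apply: eq_card => x; rewrite !inE.
Qed.

(** * Construction of the orthogonal square *)

Lemma card_quarters (T : finType) (A B : {set T}) (r : nat) (u v : bool) :
    #|T| = 4 * r -> #|A| = 2 * r -> #|B| = 2 * r -> #|A :&: B| = r ->
  #|[set x | ((x \in A) == u) && ((x \in B) == v)]| = r.
Proof.
move=> cardT cardA cardB cardAB.
have -> : [set x | ((x \in A) == u) && ((x \in B) == v)] =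
    (if u then A else ~: A) :&: (if v then B else ~: B).
  by apply/setP => x; rewrite !inE; case: u v => [] []; rewrite /= ?inE ?eqb_id ?eqbF_neg.
have := cardsID B A; have := cardsID A B; have := cardsC A; have := cardsC B.
have := cardsID B (~: A).
by case: u v => [] []; rewrite -?setDE ?[~: A :&: B]setIC -?setDE ?[B :&: A]setIC; lia.
Qed.

(** Lets squares over ['I_(n %/ (n %/ 2))] be handled as Boolean arrays, with no cast to ['I_2]. *)
Lemma two_symbols (q : nat) : q = 2 -> exists sym : bool -> 'I_q, bijective sym.
Proof.
move=> ->; exists (fun b : bool => inord b).
exists (fun i : 'I_2 => i == 1 :> nat) => [b|i].
  by rewrite inordK; case: b.
by apply/val_inj; case: i => [[|[|//]]] i_lt2; rewrite /= inordK.
Qed.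

(** For even n the computed index is below n, so the default [j] of [insubd] never intervenes. *)
Definition shift_half (n : nat) (j : 'I_n) : 'I_n :=
  insubd j (if j < n %/ 2 then j + n %/ 2 else j - n %/ 2).

Lemma val_shift_half (n : nat) (j : 'I_n) : 2 %| n ->
  shift_half j = (if j < n %/ 2 then j + n %/ 2 else j - n %/ 2) :> nat.
Proof.
move=> n_even; rewrite val_insubd; have lt_j := ltn_ord j.
by rewrite ifT //; case: ifP; lia.
Qed.

Lemma shift_halfK (n : nat) : 2 %| n -> involutive (@shift_half n).
Proof.
move=> n_even j; apply/val_inj; rewrite /= !val_shift_half //.
by have := ltn_ord j; case: (ltnP j (n %/ 2)) => ? ?; case: ltnP; lia.
Qed.

Theorem theorem3p1 (k n : nat) (hk : 1 <= k) (hn : 0 < n)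
    (hdvd : 4 * mseq (2 * k) %| n) :
  ~ exists S : {set square n (n %/ 2)}, maxMOFS k S.
Proof.
case=> S [[cardS freqS _] maxS]; apply: maxS.
have [r En] : exists r, n = 4 * r.
  by have /dvdnP[x ->] := hdvd; exists (x * mseq (2 * k)); lia.
have r_gt0 : 0 < r by lia.
have n_even : 2 %| n by lia.
have half_n : n %/ 2 = 2 * r by lia.
have /two_symbols[sym [bit symK bitK]] : n %/ (n %/ 2) = 2.
  by rewrite half_n En -[4]/(2 * 2) -mulnA mulnK // muln_gt0.
have bitE s t : (s == t) = (bit s == bit t) by rewrite (inj_eq (can_inj bitK)).
have cardF F j : F \in S -> #|[set i | bit (F i j)]| = 2 * r.
  move=> FS; have [_ /(_ j) cardFj] := freqS F FS (sym true).
  rewrite -half_n -[RHS]cardFj.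
  by apply: eq_card => i; rewrite !inE bitE symK eqb_id.
(* The 2k coordinates of a row: its entries in column j and in the partner column, for each
   square. *)
pose bs (j : 'I_n) :=
  [seq (fun i : 'I_n => bit (F i j)) | F : square n (n %/ 2) <- enum S] ++
  [seq (fun i : 'I_n => bit (F i (shift_half j))) | F : square n (n %/ 2) <- enum S].
have size_bs j : size (bs j) = 2 * k.
  by rewrite size_cat !size_map -cardE cardS; lia.
have /fin_all_exists[R RP] (j : 'I_n) : exists R : {set 'I_n}, 2 * #|R| = n /\
    all (fun b => 2 * #|[set i in R | b i]| == #|R|) (bs j).
  have := @balanced_half_set 'I_n (bs j).
  rewrite size_bs card_ord; apply=> //; first by lia.
  by rewrite all_cat !all_map; apply/andP; split; apply/allP => F;
    rewrite mem_enum => /cardF /= ->; lia.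
(* Both columns of a pair use the set [R] of the lower one; [g] is true on it in the lower column
   and off it in the upper. *)
pose low (j : 'I_n) := if j < n %/ 2 then j else shift_half j.
pose g (i j : 'I_n) := (i \in R (low j)) == (j < n %/ 2).
have cardR j : #|R j| = 2 * r by have [] := RP j; lia.
have RF F j : F \in S -> #|[set i | bit (F i j)] :&: R j| = r /\
    #|[set i | bit (F i (shift_half j))] :&: R j| = r.
  move=> FS; have [_] := RP j; rewrite all_cat !all_map => /andP[].
  rewrite -mem_enum in FS.
  move=> /allP/(_ F FS) /= /eqP E1 /allP/(_ F FS) /= /eqP E2.
  by split; apply/eqP; rewrite -(eqn_pmul2l (m := 2)) // -(cardR j);
    [rewrite -E1 | rewrite -E2]; rewrite eqn_pmul2l //; apply/eqP;
    apply: eq_card => i; rewrite !inE andbC.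
have cardFR F (j : 'I_n) : F \in S -> #|[set i | bit (F i j)] :&: R (low j)| = r.
  move=> FS; rewrite /low; case: ifP => _; first by have [] := RF F j FS.
  by have [_] := RF F (shift_half j) FS; rewrite shift_halfK.
have lt_shift (j : 'I_n) : (shift_half j < n %/ 2) = ~~ (j < n %/ 2).
  by rewrite val_shift_half //; have := ltn_ord j; case: (ltnP j (n %/ 2)) => ? ?; lia.
have g_shift i j : g i (shift_half j) = ~~ g i j.
  rewrite /g /low lt_shift shift_halfK //.
  by case: (j < _); case: (i \in _).
have gE i j v : (g i j == v) = ((i \in R (low j)) == ((j < n %/ 2) == v)).
  by rewrite /g; case: (i \in _) (j < _) v => [] [] [].
exists (\matrix_(i, j) sym (g i j))%R; split=> [s|F FS s t].
  have half_card (A : {set 'I_n}) : #|~: A| = #|A| -> #|A| = n %/ 2.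
    by move=> EA; have := cardsC A; rewrite EA card_ord; lia.
  split=> [i|j].
    transitivity #|[set j | g i j == bit s]|.
      by apply: eq_card => j; rewrite !inE mxE bitE symK.
    (* Within a row, [shift_half] exchanges the columns holding s with the others. *)
    apply: half_card; rewrite -[RHS](card_preimset _ (inv_inj (shift_halfK n_even))).
    by apply: eq_card => j; rewrite !inE g_shift; case: (g i j) (bit s) => [] [].
  transitivity #|[set i | g i j == bit s]|.
    by apply: eq_card => i; rewrite !inE mxE bitE symK.
  have -> : [set i | g i j == bit s] =
      if (j < n %/ 2) == bit s then R (low j) else ~: R (low j).
    apply/setP => i; rewrite inE gE.
    by case: ((j < _) == _); rewrite ?inE ?eqb_id ?eqbF_neg.
  apply: half_card; have := cardsC (R (low j)); have := cardR (low j); rewrite card_ord.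
  by case: ifP; rewrite ?setCK; lia.
(* Orthogonality holds column by column: each of the 4r columns contributes r cells to each pair of
   symbols, and 4r r = (2r)^2. *)
have -> : (n %/ 2) ^ 2 = \sum_(j < n) r.
  by rewrite sum_nat_const card_ord half_n En; lia.
rewrite -sum1dep_card big_mkcond /=.
rewrite -(pair_bigA _ (fun i j => if (F i j == s) &&
  ((\matrix_(i, j) sym (g i j))%R i j == t) then 1 else 0)) exchange_big /=.
apply: eq_bigr => j _; rewrite -big_mkcond sum1dep_card.
transitivity #|[set i | ((i \in [set i | bit (F i j)]) == bit s)
    && ((i \in R (low j)) == ((j < n %/ 2) == bit t))]|.
  by apply: eq_card => i; rewrite !inE mxE !bitE symK gE.
by apply: card_quarters; rewrite ?card_ord ?cardF ?cardR ?cardFR.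
Qed.
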